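(* Let $m\ge2$ be an even integer. Suppose there exists an $\mathrm{OA}_I(\ell,r,s,s)_\lambda$ with symbols $0,1,\ldots,s-1$ and $s\ge m+1$. Suppose $A_1,\ldots,A_s,B_1,\ldots,B_s$ are rational numbers such that the $4s$ numbers $\pm A_1,\ldots,\pm A_s,\pm B_1,\ldots,\pm B_s$ are mutually distinct and (1) $[A_1,\ldots,A_s]=^s_m[B_1,\ldots,B_s]$, (2) $\sum_{i=1}^sA_i^{m+2}=\sum_{i=1}^sB_i^{m+2}$, (3) $\sum_{i=1}^sA_i=\sum_{i=1}^sB_i=0$. Let $X$ be the multiset of $2\ell$ vectors $\pm(A_{c_1+1},\ldots,A_{c_r+1})$, where $(c_1,\ldots,c_r)$ ranges over the rows of the Type-I orthogonal array, and let $Y$ be defined in the same way with $B$ in place of $A$. Then $(X,Y)$ is a $\mathrm{PTE}_r$ solution of degree $m+3$ and size $2\ell$.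
   Context: For positive integers with $s\ge t$, an orthogonal array of Type I, $\mathrm{OA}_I(\ell,r,s,t)_\lambda$, is an $\ell\times r$ array with entries from a set of $s$ symbols such that in every $\ell\times t$ subarray each of the $s!/(s-t)!$ ordered $t$-tuples of pairwise distinct symbols occurs as a row exactly $\lambda$ times (and no other rows occur). For multisets $A=\{\mathbf{a}_1,\ldots,\mathbf{a}_n\}$, $B=\{\mathbf{b}_1,\ldots,\mathbf{b}_n\}\subset\mathbb{Q}^r$ with $\mathbf{a}_i=(a_{i1},\ldots,a_{ir})$, $\mathbf{b}_i=(b_{i1},\ldots,b_{ir})$, $[A]=^n_m[B]$ (a $\mathrm{PTE}_r$ solution of degree $m$ and size $n$) means $A,B$ have no common element and $\sum_i\prod_j a_{ij}^{k_j}=\sum_i\prod_j b_{ij}^{k_j}$ for all nonnegative integers $k_j$ with $1\le\sum_jk_j\le m$; for $r=1$ this reads $\sum_i a_i^k=\sum_i b_i^k$ for $1\le k\le m$. *)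

(* Defs.v *)
From HB Require Import structures.
From mathcomp Require Import all_boot all_order all_algebra.
Set Implicit Arguments.
Unset Strict Implicit.
Unset Printing Implicit Defensive.
Import Order.TTheory GRing.Theory Num.Theory.
Local Open Scope ring_scope.

(* An l x t subarray is a choice of t columns in increasing order.  The
   condition t <= r, implicit in the notion of strength t, is made explicit:
   without it the subarray condition would be vacuous. *)
Definition OA_I (S : finType) (l r s t lam : nat) (M : 'M[S]_(l, r)) : Prop :=
  [/\ [/\ (0 < l)%N, (0 < r)%N, (0 < t)%N & (0 < lam)%N],
      (t <= s)%N, (t <= r)%N, #|S| = s
    & forall f : 'I_t -> 'I_r, {homo f : i j / (i < j)%N} ->
        (forall i : 'I_l, injective (row i (colsub f M) ord0))
        /\ (forall u : 'rV[S]_t, injective (u ord0) ->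
              #|[set i : 'I_l | row i (colsub f M) == u]| = lam)].

(* Multisets of vectors are given by sequences; every condition below is
   invariant under permutation of the sequences. *)
Definition PTE (r m n : nat) (A B : seq 'rV[rat]_r) : Prop :=
  [/\ size A = n, size B = n,
      (forall v, v \in A -> v \notin B)
    & forall k : 'I_r -> nat, (1 <= \sum_j k j <= m)%N ->
        \sum_(a <- A) \prod_j a ord0 j ^+ k j
        = \sum_(b <- B) \prod_j b ord0 j ^+ k j].

Definition vec1 (s : nat) (A : 'I_s -> rat) : seq 'rV[rat]_1 :=
  [seq const_mx (A i) | i : 'I_s].

Definition signed_rows (l r s : nat) (M : 'M['I_s]_(l, r)) (A : 'I_s -> rat) :
    seq 'rV[rat]_r :=
  [seq map_mx A (row i M) | i : 'I_l] ++ [seq - map_mx A (row i M) | i : 'I_l].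

(* Main.v *)
Require Import Defs.
From HB Require Import structures.
From mathcomp Require Import all_boot all_order all_algebra.
From mathcomp Require Import zify.
Set Implicit Arguments.
Unset Strict Implicit.
Unset Printing Implicit Defensive.
Import Order.TTheory GRing.Theory Num.Theory.
Local Open Scope ring_scope.

(** An array of strength [s] on [s] symbols with [s >= 3] has exactly [s]
    columns, and its rows are the permutations of the symbols, each occurring
    [lam] times.  Hence the moments of the unsigned rows are multiples of the
    monomial sums over tuples of distinct indices.  These are polynomials in the
    power sums [p_1, ..., p_d], where [d] is the degree.  For odd [d] the signs
    cancel; for even [d <= m] the power sums agree; and for [d = m + 2] the only
    power sum that may differ, [p_(m+1)], occurs only in the product
    [p_(m+1) p_1], which vanishes. *)

Definition powersum (R : pzSemiRingType) (s : nat) (A : 'I_s -> R) (k : nat) : R :=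
  \sum_(i < s) A i ^+ k.

(** An augmented monomial symmetric polynomial evaluated at [A]. Zero exponents are allowed, and
    their indices still have to avoid the others. *)
Definition distinct_monomial_sum (R : pzSemiRingType) (s n : nat) (A : 'I_s -> R)
    (k : 'I_n -> nat) : R :=
  \sum_(t : n.-tuple 'I_s | uniq t) \prod_(j < n) A (tnth t j) ^+ k j.

Lemma sum_tupleS (V : nmodType) (T : finType) (n : nat) (P : pred (n.+1.-tuple T))
    (F : n.+1.-tuple T -> V) :
  \sum_(t | P t) F t
  = \sum_(t : n.-tuple T) \sum_(x | P [tuple of x :: t]) F [tuple of x :: t].
Proof.
rewrite pair_big_dep /=.
rewrite (reindex (fun p : n.-tuple T * T => [tuple of p.2 :: p.1])) //=.
exists (fun t : n.+1.-tuple T => ([tuple of behead t], thead t)).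
- by move=> [t x] _ /=; congr (_, _); apply: val_inj.
- by move=> t _; rewrite [RHS]tuple_eta; apply: val_inj.
Qed.

(** Merging an exponent into position [j] preserves the total degree, so inductions on the tuple
    length can keep the degree fixed. *)
Lemma sum_add_indicator (n c : nat) (k : 'I_n -> nat) (j : 'I_n) :
  (\sum_i (k i + (i == j) * c) = c + \sum_i k i)%N.
Proof.
rewrite big_split /= addnC; congr addn.
by rewrite (bigD1 j) //= eqxx mul1n big1 ?addn0 // => i /negPf ->.
Qed.

(* The first index of a tuple ranges over all indices except those occurring
   in the rest, and a coincidence merges two exponents. *)
Lemma distinct_monomial_sumS (R : comPzRingType) (s n : nat) (A : 'I_s -> R)
    (k : 'I_n.+1 -> nat) :
  distinct_monomial_sum A k
  = powersum A (k ord0) * distinct_monomial_sum A (fun j => k (lift ord0 j))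
    - \sum_(j < n) distinct_monomial_sum A
        (fun i => k (lift ord0 i) + (i == j) * k ord0)%N.
Proof.
rewrite /distinct_monomial_sum sum_tupleS exchange_big /= mulr_sumr -sumrB.
rewrite [RHS]big_mkcond; apply: eq_bigr => t _ /=.
case: (boolP (uniq t)) => [Ut|_]; last first.
  by rewrite big1 // => x; rewrite andbF.
pose G := \prod_(j < n) A (tnth t j) ^+ k (lift ord0 j).
rewrite (eq_bigr (fun x => A x ^+ k ord0 * G)); last first.
  move=> x _; rewrite big_ord_recl tnth0; congr (_ * _).
  by apply: eq_bigr => j _; rewrite tnthS.
rewrite (eq_bigl (fun x => x \notin t)); last by move=> x; rewrite andbT.
(* The full power sum splits by membership in [t]; as [t] has no repetition, the part inside [t] is
   a sum over positions. *)
rewrite -mulr_suml /powersum (bigID (fun x => x \in t) predT) /= mulrDl.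
rewrite -big_uniq //= big_tuple -/G.
suff -> : (\sum_(j < n) A (tnth t j) ^+ k ord0) * G = \sum_(j < n) \prod_(i < n)
    A (tnth t i) ^+ (k (lift ord0 i) + (i == j) * k ord0) by rewrite addrAC subrr add0r.
rewrite mulr_suml; apply: eq_bigr => j _.
under [RHS]eq_bigr do rewrite exprD.
rewrite big_split /= -/G mulrC; congr (_ * _).
by rewrite (bigD1 j) //= eqxx mul1n big1 ?mulr1 // => i /negPf ->.
Qed.

(** In the recursion the merged terms again have degree 1. In the product, the only nonzero exponent
    either yields the factor [powersum A 1] or lies in the shorter sum. *)
Lemma distinct_monomial_sum_deg1 (R : comPzRingType) (s n : nat) (A : 'I_s -> R)
    (k : 'I_n -> nat) :
  powersum A 1 = 0 -> (\sum_j k j = 1)%N -> distinct_monomial_sum A k = 0.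
Proof.
move=> p1; elim: n k => [k|n IHn k k1]; first by rewrite big_ord0.
have k1' := k1; rewrite big_ord_recl in k1'.
rewrite distinct_monomial_sumS (big1 _ _ (fun j => distinct_monomial_sum _ _)); last first.
  by move=> j _; apply: IHn; rewrite sum_add_indicator.
rewrite subr0; have [k0|k0] : k ord0 = 1%N \/ k ord0 = 0%N by lia.
- by rewrite k0 p1 mul0r.
- by rewrite IHn ?mulr0 //; move: k1'; rewrite k0.
Qed.

Lemma eq_distinct_monomial_sum (R : comPzRingType) (s m n : nat) (A B : 'I_s -> R)
    (k : 'I_n -> nat) :
  (forall d, (d <= m)%N || (d == m + 2)%N -> powersum A d = powersum B d) ->
  powersum A 1 = 0 -> powersum B 1 = 0 ->
  (\sum_j k j <= m)%N || (\sum_j k j == m + 2)%N ->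
  distinct_monomial_sum A k = distinct_monomial_sum B k.
Proof.
move=> pAB pA pB; elim: n k => [k _|n IHn k kd].
  by apply: eq_bigr => t _; rewrite !big_ord0.
have kd' := kd; rewrite big_ord_recl in kd'.
rewrite !distinct_monomial_sumS; congr (_ - _); last first.
  by apply: eq_bigr => j _; apply: IHn; rewrite sum_add_indicator.
set d' := (\sum_(i < n) _)%N in kd'.
have [k0|k0] := eqVneq (k ord0) 1%N; first by rewrite k0 pA pB !mul0r.
have [d1|d1] := eqVneq d' 1%N; first by rewrite !distinct_monomial_sum_deg1 ?mulr0.
(* If [k ord0 + d'] is [m + 2] and neither part is 1, then neither part is [m + 1], so both stay in
   the range where [pAB] and [IHn] apply. *)
by rewrite pAB ?IHn // -/d'; lia.
Qed.

(** With more than [s] columns, a row would have distinct entries in its first [s + 1] columns,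
    against the pigeonhole principle. *)
Lemma OA_I_full_strength_columns (S : finType) (l r s lam : nat) (M : 'M[S]_(l, r)) :
  OA_I s s lam M -> (2 <= s)%N -> r = s.
Proof.
move=> [[l0 _ _ _] _ sr cardS MP] s2.
apply/eqP; rewrite eqn_leq sr andbT leqNgt; apply/negP => ltsr.
pose i0 := Ordinal l0.
suff /leq_card : injective (fun j : 'I_s.+1 => M i0 (widen_ord ltsr j)).
  by rewrite card_ord cardS ltnn.
move=> j1 j2 eqM; apply/eqP/negPn/negP => j12.
have [h hj] : exists h : 'I_s.+1, h \notin [set j1; j2].
  have : (0 < #|~: [set j1; j2]|)%N.
    by have := cardsC [set j1; j2]; rewrite cards2 card_ord; lia.
  by case/card_gt0P => h; rewrite inE; exists h.
move: hj; rewrite !inE negb_or => /andP[/unlift_some[i1 e1 _] /unlift_some[i2 e2 _]].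
have [|inj _] := MP (fun i => widen_ord ltsr (lift h i)).
  by move=> i j /=; rewrite /bump; lia.
move: j12; rewrite e1 e2 (inj i0 i1 i2) ?eqxx //.
by rewrite !mxE -e1 -e2.
Qed.

(** The only choice of [s] increasing columns is the identity, so grouping equal rows gives [lam]
    copies of each repetition-free tuple. *)
Lemma sum_rows_OA_I (R : comPzRingType) (l s lam : nat) (M : 'M['I_s]_(l, s))
    (A : 'I_s -> R) (k : 'I_s -> nat) :
  OA_I s s lam M ->
  \sum_(i < l) \prod_j A (M i j) ^+ k j = distinct_monomial_sum A k *+ lam.
Proof.
move=> [_ _ _ _ /(_ id)[//|Minj Mcard]].
pose T i := [tuple M i j | j < s].
have uT i : uniq (T i).
  rewrite map_inj_uniq ?enum_uniq // => j1 j2 e.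
  by apply: (Minj i); rewrite !mxE.
rewrite (partition_big T (fun t => uniq t)) /=; last by move=> i _; apply: uT.
rewrite /distinct_monomial_sum -sumrMnl.
apply: eq_bigr => t Ut.
rewrite (eq_bigr (fun _ => \prod_(j < s) A (tnth t j) ^+ k j)); last first.
  by move=> i /eqP <-; apply: eq_bigr => j _; rewrite tnth_mktuple.
rewrite sumr_const -(Mcard (\row_j tnth t j)); last first.
  by move=> j1 j2; rewrite !mxE => /(tuple_uniqP _ Ut).
congr (_ *+ _); rewrite cardsE; apply: eq_card => i.
apply: (_ : (T i == t) = (row i (colsub id M) == \row_j tnth t j)).
apply/eqP/eqP => [<-|e].
- by apply/rowP => j; rewrite !mxE tnth_mktuple.
- apply: eq_from_tnth => j; rewrite tnth_mktuple.
  by have /rowP/(_ j) := e; rewrite !mxE.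
Qed.

Lemma sum_signed_rows (l r s : nat) (M : 'M['I_s]_(l, r)) (A : 'I_s -> rat)
    (k : 'I_r -> nat) :
  \sum_(a <- signed_rows M A) \prod_j a ord0 j ^+ k j
  = (1 + (-1) ^+ (\sum_j k j)) * \sum_(i < l) \prod_j A (M i j) ^+ k j.
Proof.
rewrite /signed_rows big_cat !big_image /= mulrDl mul1r; congr (_ + _).
  by apply: eq_bigr => i _; apply: eq_bigr => j _; rewrite !mxE.
rewrite mulr_sumr; apply: eq_bigr => i _.
rewrite -prodrXr -big_split /=; apply: eq_bigr => j _.
by rewrite !mxE -exprMn mulN1r.
Qed.

Lemma signed_rows_entry (l r s : nat) (M : 'M['I_s]_(l, r)) (A : 'I_s -> rat)
    (v : 'rV[rat]_r) (j : 'I_r) :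
  v \in signed_rows M A ->
  v ord0 j \in [seq A i | i : 'I_s] ++ [seq - A i | i : 'I_s].
Proof.
rewrite !mem_cat => /orP[] /imageP[i _ ->]; apply/orP; [left|right];
  by apply/imageP; exists (M i j); rewrite ?mxE.
Qed.

Theorem theorem5p5 (m l r s lam : nat) (M : 'M['I_s]_(l, r))
    (A B : 'I_s -> rat)
    (hm : (2 <= m)%N) (hme : ~~ odd m)
    (hOA : OA_I s s lam M) (hs : (m + 1 <= s)%N)
    (hdist : uniq ([seq A i | i : 'I_s] ++ [seq - A i | i : 'I_s]
                   ++ [seq B i | i : 'I_s] ++ [seq - B i | i : 'I_s]))
    (h1 : PTE m s (vec1 A) (vec1 B))
    (h2 : \sum_(i < s) A i ^+ (m + 2) = \sum_(i < s) B i ^+ (m + 2))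
    (h3A : \sum_(i < s) A i = 0) (h3B : \sum_(i < s) B i = 0) :
  PTE (m + 3) (2 * l) (signed_rows M A) (signed_rows M B).
Proof.
have rs : r = s by apply: OA_I_full_strength_columns hOA _; lia.
subst r; split.
- by rewrite size_cat !size_image card_ord mul2n addnn.
- by rewrite size_cat !size_image card_ord mul2n addnn.
- move=> v vA; apply/negP => vB.
  have s0 : (0 < s)%N by lia.
  (* One coordinate of a common vector would already be both some [± A i] and some [± B j]. *)
  move: hdist; rewrite catA cat_uniq => /and3P[_ /hasPn/(_ (v ord0 (Ordinal s0))) h _].
  by have := h (signed_rows_entry _ vB); rewrite (signed_rows_entry _ vA).
move=> k /andP[k1 km]; rewrite !sum_signed_rows.
case: (boolP (odd (\sum_j k j))) => kodd.
  by rewrite -signr_odd kodd subrr !mul0r.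
rewrite !(sum_rows_OA_I _ _ hOA); congr (_ * (_ *+ _)).
have p1 (C : 'I_s -> rat) : powersum C 1 = \sum_i C i by [].
(* As [m] is even, an even degree up to [m + 3] is at most [m] or equal to [m + 2]. *)
apply: (@eq_distinct_monomial_sum _ _ m); rewrite ?p1 //; last by lia.
(* [h1] says nothing about exponent 0, where both power sums count the [s] indices. *)
move=> d /orP[dm|/eqP -> //]; case: d dm => [_|d dm].
  by apply: eq_bigr => i _; rewrite !expr0.
have [_ _ _ /(_ (fun=> d.+1))] := h1.
rewrite big_ord1 dm => /(_ isT); rewrite /vec1 !big_image /=.
under eq_bigr do rewrite big_ord1 mxE.
by under [RHS]eq_bigr do rewrite big_ord1 mxE.
Qed.
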